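(* In the block tree generalized random energy model with weights $a_1,\dots,a_n\ge0$ described in the context, for $\beta>0$ the limiting free energy $\mathcal{E}(\beta)=\lim_{N\to\infty}\frac1N\log Z_N(\beta)$ exists almost surely and $$\mathcal{E}(\beta)=\max_\pi\mathcal{E}^\pi(\beta),$$ the maximum being over all permutations $\pi$ of $\{1,\dots,n\}$, where $\mathcal{E}^\pi(\beta)$ denotes the almost sure limit of $\frac1N\log Z_N^\pi(\beta)$.
   Context: For each $N\ge n$ let $k(1,N),\dots,k(n,N)\ge1$ be integers with sum $N$ and $\frac{k(i,N)}N\to p_i>0$ as $N\to\infty$. Write $\sigma\in\{+1,-1\}^N$ as $\sigma_1\cdots\sigma_n$ with $\sigma_i\in\{+1,-1\}^{k(i,N)}$. For each $N$, for every finite non-empty sequence $s=\langle j_1,\dots,j_i\rangle$ of distinct elements of $\{1,\dots,n\}$ and every $\langle\sigma_{j_1},\dots,\sigma_{j_i}\rangle\in\{+1,-1\}^{k(j_1,N)}\times\cdots\times\{+1,-1\}^{k(j_i,N)}$ there is a random variable $\xi^{j_1\cdots j_i}_{\sigma_{j_1}\cdots\sigma_{j_i}}$; for fixed $N$ all these are independent $\mathcal{N}(0,N)$, and all $N$ are on one probability space. For a permutation $\pi$ of $\{1,\dots,n\}$ and $\sigma\in\{+1,-1\}^N$ the Hamiltonian is $$H_N(\sigma,\pi)=\sum_{i=1}^na_{\pi(i)}\,\xi^{\pi(1)\pi(2)\cdots\pi(i)}_{\sigma_{\pi(1)}\sigma_{\pi(2)}\cdots\sigma_{\pi(i)}}.$$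 $Z_N^\pi(\beta)=\sum_{\sigma\in\{+1,-1\}^N}e^{-\beta H_N(\sigma,\pi)}$ (for fixed $\pi$ this is the partition function of an $n$-level Gaussian GREM with $2^{k(\pi(i),N)}$ nodes at level $i$ below each level-$(i-1)$ node and weight $a_{\pi(i)}$ at level $i$; the almost sure limit of $\frac1N\log Z_N^\pi(\beta)$ exists and is nonrandom), and $Z_N(\beta)=\sum_\pi Z_N^\pi(\beta)$, the sum over all permutations. *)

(* Defs.v *)
From mathcomp Require Export all_boot all_order all_algebra all_fingroup.
From mathcomp Require Export all_classical all_reals all_analysis.

Set Implicit Arguments.
Unset Strict Implicit.
Unset Printing Implicit Defensive.

Import Order.TTheory GRing.Theory Num.Theory.
Import numFieldNormedType.Exports.

Local Open Scope classical_set_scope.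
Local Open Scope ring_scope.

(* Mutual independence of the subfamily (X i), i \in D: the product rule for
   every finite choice of distinct indices in D and measurable sets. *)
Definition mutually_independent (d : measure_display) (T : measurableType d)
    (R : realType) (P : probability T R) (I : eqType) (D : pred I)
    (X : I -> {RV P >-> R}) : Prop :=
  forall (s : seq I) (A : I -> set R),
    uniq s -> all D s -> (forall i, measurable (A i)) ->
    P (\big[setI/setT]_(i <- s) (X i @^-1` A i)) =
    (\prod_(i <- s) P (X i @^-1` A i))%E.

(* Spins +1, -1 are encoded as true, false; only the labels matter.
   Block i of sigma when sigma is cut into n consecutive pieces of lengths
   k 0, ..., k n.-1. *)
Definition block (n : nat) (k : 'I_n -> nat) (sigma : seq bool) (i : 'I_n)
    : seq bool :=
  nth [::] (reshape [seq k j | j <- enum 'I_n] sigma) i.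

(* The pair of <j_1, ..., j_i> and <sigma_{j_1}, ..., sigma_{j_i}> is encoded
   as the single sequence [:: (j_1, sigma_{j_1}); ...; (j_i, sigma_{j_i})]. *)
Definition label (n : nat) : Type := seq ('I_n * seq bool).

Definition valid_label (n : nat) (k : 'I_n -> nat) : pred (label n) :=
  fun v => [&& v != [::], uniq (unzip1 v)
             & all (fun x => size x.2 == k x.1) v].

(* Level i : 'I_n counts from 0, hence the prefix of length i.+1. *)
Definition path_label (n : nat) (k : 'I_n -> nat) (sigma : seq bool)
    (pi : 'S_n) (i : 'I_n) : label n :=
  take i.+1 [seq (pi j, block k sigma (pi j)) | j <- enum 'I_n].

Definition hamiltonian (R : realType) (n : nat) (k : 'I_n -> nat)
    (a : 'I_n -> R) (xi : label n -> R) (sigma : seq bool) (pi : 'S_n) : R :=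
  \sum_(i < n) a (pi i) * xi (path_label k sigma pi i).

Definition Zperm (R : realType) (n : nat) (k : 'I_n -> nat)
    (a : 'I_n -> R) (xi : label n -> R) (N : nat) (beta : R) (pi : 'S_n) : R :=
  \sum_(sigma : N.-tuple bool) expR (- beta * hamiltonian k a xi sigma pi).

Definition Ztotal (R : realType) (n : nat) (k : 'I_n -> nat)
    (a : 'I_n -> R) (xi : label n -> R) (N : nat) (beta : R) : R :=
  \sum_(pi : 'S_n) Zperm k a xi N beta pi.

(* Main.v *)
Require Import Defs.
From mathcomp Require Import lra.

Import Order.TTheory GRing.Theory Num.Theory.
Import numFieldNormedType.Exports.

Local Open Scope classical_set_scope.
Local Open Scope ring_scope.

(** The total partition function is a sum of the fixed number n! of positive
partition functions, one for each permutation. A sum of finitely many positive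
numbers lies between its largest term and the number of terms times that term,
so the logarithm of the sum exceeds the largest logarithm by at most ln n!
(lemmas [ler_ln_sum] and [ln_sum_le]). Divided by N, this error vanishes, and
the limit of the logarithm of the sum is the largest of the individual limits
([cvg_ln_sum]). This is deterministic: it applies at each sample point at which
all the free energies of the single permutations converge, and as there are
finitely many permutations, almost every point is of this kind. *)

Lemma ler_ln_sum (R : realType) (I : finType) (z : I -> R) (j : I) :
  (forall i, 0 < z i) -> ln (z j) <= ln (\sum_i z i).
Proof.
move=> z_gt0; have le_z : z j <= \sum_i z i.
  by rewrite (bigD1 j) //= lerDl sumr_ge0 // => i _; exact: ltW.
by rewrite ler_ln // posrE //; exact: lt_le_trans le_z.
Qed.

(** The index j excludes the empty sum: as [ln 0 = 0], the bound would fail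
there for negative m. *)
Lemma ln_sum_le (R : realType) (I : finType) (z : I -> R)
    (j : I) (m : R) :
  (forall i, 0 < z i) -> (forall i, ln (z i) <= m) ->
  ln (\sum_i z i) <= m + ln #|I|%:R.
Proof.
move=> z_gt0 z_le.
have I_gt0 : 0 < #|I|%:R :> R by rewrite ltr0n; apply/card_gt0P; exists j.
have sum_gt0 : 0 < \sum_i z i.
  by rewrite (bigD1 j) //= ltr_pwDl // sumr_ge0 // => i _; exact: ltW.
rewrite -[m]expRK -lnM ?posrE ?expR_gt0 // ler_ln ?posrE ?mulr_gt0 ?expR_gt0 //.
rewrite mulr_natr -sumr_const ler_sum // => i _.
by rewrite -[z i]lnK ?posrE // ler_expR.
Qed.

(** The Laplace principle for a fixed finite number of terms. The base point i0
starts the maximum; being the limit of one of the terms, its value does not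
change it. *)
Lemma cvg_ln_sum (R : realType) (I : finType) (z : nat -> I -> R)
    (e : I -> R) (i0 : I) :
  (forall N i, 0 < z N i) ->
  (forall i, (fun N => ln (z N i) / N%:R) @ \oo --> e i) ->
  (fun N => ln (\sum_i z N i) / N%:R) @ \oo --> \big[Num.max/e i0]_i e i.
Proof.
move=> z_gt0 z_lim.
set M := \big[Num.max/e i0]_i e i.
have e_le i : e i <= M by exact: le_bigmax.
have [j Mj] : exists j, M = e j.
  rewrite /M; apply: (big_ind (fun x => exists j, x = e j)); first by exists i0.
    by move=> x y [j ->] [k ->]; case: (leP (e j) (e k)) => _; [exists k | exists j].
  by move=> i _; exists i.
have card_lim : (fun N => ln (#|I|%:R : R) / N%:R) @ \oo --> (0 : R).
  rewrite -(mulr0 (ln (#|I|%:R : R))); apply: cvgMl_tmp.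
  by apply/gtr0_cvgV0; [exact: nbhs_infty_gtr | exact: cvgr_idn].
apply/cvgrPdist_le => eps eps_gt0.
have near_term : \forall N \near \oo, forall i, `|e i - ln (z N i) / N%:R| <= eps / 2.
  apply: filter_forall => i.
  by have /cvgrPdist_le := z_lim i; apply; rewrite divr_gt0.
have near_card : \forall N \near \oo, `|0 - ln (#|I|%:R : R) / N%:R| <= eps / 2.
  by have /cvgrPdist_le := card_lim; apply; rewrite divr_gt0.
(* Both errors, of the terms and of their number, get half of eps; N > 0 is what
   allows clearing the denominator. *)
near=> N.
have N_gt0 : 0 < N%:R :> R by rewrite ltr0n; near: N; exact: nbhs_infty_gt.
have dist_z i : `|e i - ln (z N i) / N%:R| <= eps / 2.
  by move: i; near: N.
have dist_card : `|0 - ln (#|I|%:R : R) / N%:R| <= eps / 2 by near: N.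
rewrite ler_distlC; apply/andP; split.
  have := dist_z j; rewrite ler_distlC -Mj => /andP[lo _].
  apply: (@le_trans _ _ (ln (z N j) / N%:R)); first lra.
  by rewrite ler_pM2r ?invr_gt0 //; exact: ler_ln_sum.
have ln_le i : ln (z N i) <= (M + eps / 2) * N%:R.
  rewrite -ler_pdivrMr //.
  by have := dist_z i; rewrite ler_distlC => /andP[_ hi]; have := e_le i; lra.
rewrite ler_pdivrMr //.
apply: le_trans (@ln_sum_le _ _ _ i0 _ (z_gt0 N) ln_le) _.
move: dist_card; rewrite ler_distlC => /andP[_]; rewrite ler_pdivrMr // => hi.
lra.
Unshelve. all: by end_near. Qed.

Lemma Zperm_gt0 (R : realType) (n : nat) (k : 'I_n -> nat) (a : 'I_n -> R)
    (xi : label n -> R) (N : nat) (beta : R) (pi : 'S_n) :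
  0 < Zperm k a xi N beta pi.
Proof.
rewrite /Zperm (bigD1 [tuple of nseq N true]) //=.
by rewrite ltr_pwDl ?expR_gt0 // sumr_ge0 // => s _; exact: expR_ge0.
Qed.

Theorem theorem3p6p1
  (d : measure_display) (T : measurableType d) (R : realType)
  (P : probability T R)
  (n : nat) (a : 'I_n -> R) (p : 'I_n -> R) (k : nat -> 'I_n -> nat)
  (xi : nat -> label n -> {RV P >-> R})
  (a_ge0 : forall i, 0 <= a i)
  (k_ge1 : forall N, (n <= N)%N -> forall i, (1 <= k N i)%N)
  (k_sum : forall N, (n <= N)%N -> (\sum_(i < n) k N i)%N = N)
  (p_gt0 : forall i, 0 < p i)
  (k_lim : forall i, (fun N : nat => (k N i)%:R / N%:R : R) @ \oo --> p i)
  (xi_normal : forall N, (n <= N)%N ->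
     forall v : label n, valid_label (k N) v ->
     forall A : set R, measurable A ->
       distribution P (xi N v) A = normal_prob 0 (Num.sqrt N%:R) A)
  (xi_indep : forall N, (n <= N)%N ->
     mutually_independent (valid_label (k N)) (xi N))
  (beta : R) (beta_gt0 : 0 < beta)
  (E : 'S_n -> R)
  (E_lim : forall pi : 'S_n, {ae P, forall w : T,
     (fun N : nat => ln (Zperm (k N) a (fun v => xi N v w) N beta pi) / N%:R)
       @ \oo --> E pi}) :
  {ae P, forall w : T,
     (fun N : nat => ln (Ztotal (k N) a (fun v => xi N v w) N beta) / N%:R)
       @ \oo --> \big[Num.max/E 1%g]_(pi : 'S_n) E pi}.
Proof.
have ae_filter := ae_filter_ringOfSetsType P.
have := filter_forall ae_filter E_lim; apply: filterS => w Ew.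
rewrite /Ztotal; apply: cvg_ln_sum => // N pi; exact: Zperm_gt0.
Qed.
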